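(* Let $A_1,\dots,A_m$ be linearly independent real symmetric $n\times n$ matrices, $C$ a real symmetric $n\times n$ matrix and $b\in\mathbb{R}^m$. Assume that the semidefinite program $$(D)\qquad \sup\ \langle b,y\rangle\quad\text{s.t.}\quad \sum_{i=1}^m y_iA_i\preceq C$$ is feasible. Consider the optimization problem $$(P_{\rm Ram})\qquad \inf\ \langle C,X\rangle$$ over symmetric $n\times n$ matrices $X, U_0,\dots,U_{n-1},V_0,\dots,V_{n-1}$, subject to $$\mathcal{A}X=b,\qquad X\in\mathcal{S}^n_++\tan(U_{n-1}),\qquad U_0=V_0=0,$$ and, for $i=1,\dots,n-1$, $$\mathcal{A}(U_i+V_i)=0,\qquad \langle C,U_i+V_i\rangle=0,\qquad U_i\in\mathcal{S}^n_+,\qquad V_i\in\tan(U_{i-1}).$$ Then the optimal values of $(D)$ and $(P_{\rm Ram})$ are equal, and the optimal value of $(P_{\rm Ram})$ is attained when it is finite.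
   Context: $\mathcal{S}^n$ is the set of real symmetric $n\times n$ matrices and $\mathcal{S}^n_+$ the set of positive semidefinite (psd) ones; $S\preceq T$ means $T-S$ is psd. $\langle S,T\rangle=\mathrm{trace}(ST)$ for symmetric matrices, $\langle b,y\rangle=b^\top y$ for vectors, and $\mathcal{A}X=(\langle A_1,X\rangle,\dots,\langle A_m,X\rangle)^\top$. For $U\in\mathcal{S}^n_+$, $$\tan(U)=\Bigl\{W+W^\top : W\in\mathbb{R}^{n\times n},\ \begin{pmatrix} U & W \\ W^\top & R \end{pmatrix}\in\mathcal{S}^{2n}_+\ \text{for some } R\in\mathcal{S}^n_+\Bigr\}.$$ The sum of sets is the Minkowski sum. Optimal values are in $\mathbb{R}\cup\{\pm\infty\}$, with the infimum over an empty set equal to $+\infty$. *)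

(* Defs.v *)
From HB Require Import structures.
From mathcomp Require Export all_boot all_order all_algebra.
From mathcomp Require Export boolp classical_sets reals ereal constructive_ereal.

#[export] Set Implicit Arguments.
#[export] Unset Strict Implicit.
#[export] Unset Printing Implicit Defensive.

Export Order.TTheory GRing.Theory Num.Theory.
Open Scope classical_set_scope.
Open Scope ring_scope.

Definition psd (R : realType) (n : nat) : set 'M[R]_n :=
  [set S | S \is symmetricmx /\ forall x : 'cV[R]_n, 0 <= (x^T *m S *m x) 0 0].

Arguments psd {R n}.

Definition loewner_le (R : realType) (n : nat) (S T : 'M[R]_n) : Prop :=
  psd (T - S).

Definition mxdot (R : realType) (n : nat) (S T : 'M[R]_n) : R := \tr (S *m T).

Definition vdot (R : realType) (m : nat) (b y : 'cV[R]_m) : R :=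
  (b^T *m y) 0 0.

Definition opA (R : realType) (m n : nat) (A : m.-tuple 'M[R]_n)
  (X : 'M[R]_n) : 'cV[R]_m := \col_(i < m) mxdot (tnth A i) X.

(* The set tan(U), meant for psd U; it is empty otherwise, as U is a principal
   block of a psd matrix. *)
Definition psd_tan (R : realType) (n : nat) (U : 'M[R]_n) : set 'M[R]_n :=
  [set W + W^T | W in [set W : 'M[R]_n |
    exists R0 : 'M[R]_n, psd R0 /\ psd (block_mx U W W^T R0)]].

Definition minkowski_add (R : realType) (n : nat) (E F : set 'M[R]_n) :
  set 'M[R]_n := [set S + T | S in E & T in F].

Definition D_feasible (R : realType) (m n : nat) (A : m.-tuple 'M[R]_n)
  (C : 'M[R]_n) (y : 'cV[R]_m) : Prop :=
  loewner_le (\sum_(i < m) y i 0 *: tnth A i) C.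

Definition D_value (R : realType) (m n : nat) (A : m.-tuple 'M[R]_n)
  (b : 'cV[R]_m) (C : 'M[R]_n) : \bar R :=
  ereal_sup [set (vdot b y)%:E | y in D_feasible A C].

(* The tuple entries U`_0, ..., U`_n.-1 are the matrices U_0, ..., U_{n-1};
   all indices used are in range as soon as 0 < n. *)
Record Ram_feasible (R : realType) (m n : nat) (A : m.-tuple 'M[R]_n)
    (b : 'cV[R]_m) (C X : 'M[R]_n) (U V : n.-tuple 'M[R]_n) : Prop := {
  Ram_X_sym : X \is symmetricmx;
  Ram_U_sym : forall i : nat, (i < n)%N -> U`_i \is symmetricmx;
  Ram_V_sym : forall i : nat, (i < n)%N -> V`_i \is symmetricmx;
  Ram_AX : opA A X = b;
  Ram_X_cone : minkowski_add psd (psd_tan U`_n.-1) X;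
  Ram_U0 : U`_0 = 0;
  Ram_V0 : V`_0 = 0;
  Ram_step_A : forall i : nat, (0 < i < n)%N -> opA A (U`_i + V`_i) = 0;
  Ram_step_C : forall i : nat, (0 < i < n)%N -> mxdot C (U`_i + V`_i) = 0;
  Ram_step_U : forall i : nat, (0 < i < n)%N -> psd U`_i;
  Ram_step_V : forall i : nat, (0 < i < n)%N -> psd_tan U`_i.-1 V`_i
}.

Definition Ram_value (R : realType) (m n : nat) (A : m.-tuple 'M[R]_n)
  (b : 'cV[R]_m) (C : 'M[R]_n) : \bar R :=
  ereal_inf [set (mxdot C X)%:E | X in
    [set X | exists U V : n.-tuple 'M[R]_n, Ram_feasible A b C X U V]].

(* Main.v *)
Require Import Defs.
From mathcomp Require Import topology normedtype derive ring lra.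
Import numFieldNormedType.Exports.

(** The value of (D) is at most that of the extended dual because every dual
slack S satisfies S U_i = 0 along a feasible chain: the pairing of S with
U_i + V_i vanishes by the two linear equations, and its pairing with V_i
vanishes since the range of the off-diagonal block defining V_i lies in the
range of U_(i-1), which S kills by induction; two psd matrices with zero
pairing have zero product.  Hence S pairs to a nonnegative number with any X
in psd + tan(U_(n-1)) ([weak_duality]).

Conversely, let v be the finite value of (D).  For psd U, the cone
psd + tan(U) is the set H_U of symmetric matrices whose quadratic form is
nonnegative on ker U ([minkowski_psd_tan]).  Write L X = (A X, <C, X>).  The
image L(H_U) is closed as soon as every Y in H_U with L Y = 0 has a form
vanishing on ker U.  In that case (b, v) is in L(H_U): a functional (z, t)
separating it strictly from L(H_U) gives a psd matrix sum z_i A_i + t C, and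
each sign of t contradicts either feasibility of (D) or the choice of v as its
value ([primal_attained]).  A preimage X of (b, v) in H_U has objective
value v.

If the closedness condition fails at U, the offending Y is the next step of a
chain: compress Y to ker U and add U to get a psd matrix of larger rank, whose
difference with Y lies in tan(U) ([Ram_step_reduce]).  After n - 1 steps
either the condition holds or ker U has dimension at most one
([facial_reduction]).  The n-th step is spared in the second case: for the
invertible matrix 1 the condition is trivial and yields some symmetric X with
L X = (b, v), and on a line the form of X + s Y is nonnegative for s large,
while L (X + s Y) = L X ([reducing_corank1]). *)

(** * Nearest points and images of closed convex cones *)

Definition rdot (R : realType) (k : nat) (u v : 'rV[R]_k) : R :=
  (u *m v^T) 0 0.

Section RowDot.
Variables (R : realType) (k : nat).
Implicit Types u v w : 'rV[R]_k.

Lemma rdotE u v : rdot u v = \sum_i u 0 i * v 0 i.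
Proof. by rewrite /rdot mxE; apply: eq_bigr => i _; rewrite mxE. Qed.

Lemma rdotC u v : rdot u v = rdot v u.
Proof. by rewrite !rdotE; apply: eq_bigr => i _; rewrite mulrC. Qed.

Lemma rdotDl u v w : rdot (u + v) w = rdot u w + rdot v w.
Proof. by rewrite /rdot mulmxDl mxE. Qed.

Lemma rdotZl a u v : rdot (a *: u) v = a * rdot u v.
Proof. by rewrite /rdot -scalemxAl mxE. Qed.

Lemma rdot0l v : rdot 0 v = 0.
Proof. by rewrite /rdot mul0mx mxE. Qed.

Lemma rdotNl u v : rdot (- u) v = - rdot u v.
Proof. by rewrite /rdot mulNmx mxE. Qed.

Lemma rdot_ge0 u : 0 <= rdot u u.
Proof. by rewrite rdotE sumr_ge0// => i _; rewrite -expr2 sqr_ge0. Qed.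

Lemma rdot_eq0 u : rdot u u = 0 -> u = 0.
Proof.
rewrite rdotE => /psumr_eq0P h; apply/rowP => i; rewrite mxE.
apply/eqP; rewrite -sqrf_eq0 expr2; apply/eqP/h => // j _.
by rewrite -expr2 sqr_ge0.
Qed.

Lemma rdot_gt0 u : u != 0 -> 0 < rdot u u.
Proof.
move=> u0; rewrite lt0r rdot_ge0 andbT; apply: contra u0 => /eqP h.
by apply/eqP/rdot_eq0.
Qed.

Lemma rdot_sqD u v t :
  rdot (u + t *: v) (u + t *: v) =
  rdot u u + (t * rdot u v *+ 2 + t ^+ 2 * rdot v v).
Proof.
rewrite !(rdotDl, rdotZl) ![rdot _ (_ + _)]rdotC !(rdotDl, rdotZl).
by rewrite [rdot v u]rdotC mulr2n expr2; ring.
Qed.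

End RowDot.

(** First-order optimality condition for minimizing a quadratic on a segment.
Restricting to t <= 1 lets it be applied along x0 - t x0, which leaves a cone
for larger t. *)
Lemma first_order_ge0 (R : realType) (a c : R) :
  (forall t, 0 < t <= 1 -> 0 <= t * a *+ 2 + t ^+ 2 * c) -> 0 <= a.
Proof.
move=> h; rewrite leNgt; apply/negP => a0.
have d0 : 0 < `|c| - a by rewrite subr_gt0 (lt_le_trans a0).
(* The value of t balances both terms and stays at most 1 whatever c is. *)
have t0 : 0 < - a / (`|c| - a) by rewrite divr_gt0// oppr_gt0.
have t1 : - a / (`|c| - a) <= 1 by rewrite ler_pdivrMr// mul1r lerDr.
have := h _ (introT andP (conj t0 t1)); set t := - a / _ in t0 t1 *.
have tc : t * c <= - a.
  apply: (@le_trans _ _ (t * `|c|)); first by rewrite ler_pM2l// ler_norm.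
  have -> : - a = t * (`|c| - a) by rewrite /t divfK// gt_eqF.
  by rewrite ler_pM2l// lerDl oppr_ge0 ltW.
rewrite expr2 mulr2n -mulrA -!mulrDr leNgt => /negP; apply.
by rewrite pmulr_rlt0//; lra.
Qed.

Lemma continuous_mulmx_coord (R : realType) (N k : nat) (M : 'M[R]_(N, k))
  (j : 'I_k) : continuous (fun x : 'rV[R]_N => (x *m M) 0 j).
Proof.
rewrite (_ : (fun y => _) = (fun y : 'rV_N => \sum_i y 0 i * M i j)).
  apply: continuous_big => [|i _ x]; first exact: add_continuous.
  by apply: (@cvgMr_tmp _ _ (nbhs x)); exact: coord_continuous.
by apply/funext => y; rewrite mxE.
Qed.

Lemma continuous_sqdist (R : realType) (N k : nat) (M : 'M[R]_(N, k))
  (p : 'rV[R]_k) :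
  continuous (fun x : 'rV[R]_N => rdot (x *m M - p) (x *m M - p)).
Proof.
rewrite (_ : (fun y => _) =
    (fun y : 'rV_N => \sum_j ((y *m M) 0 j - p 0 j) * ((y *m M) 0 j - p 0 j))).
  apply: continuous_big => [|j _ x]; first exact: add_continuous.
  have cj : (y *m M) 0 j - p 0 j @[y --> x] --> (x *m M) 0 j - p 0 j.
    by apply: (@cvgB _ _ _ (nbhs x)); [exact: continuous_mulmx_coord|
      exact: cvg_cst].
  exact: (@cvgM _ _ (nbhs x) _ _ _ _ _ cj cj).
by apply/funext => y; rewrite rdotE; apply: eq_bigr => j _; rewrite !mxE.
Qed.

Lemma continuous_sqnorm (R : realType) (N : nat) :
  continuous (fun x : 'rV[R]_N => rdot x x).
Proof.
have := @continuous_sqdist R N N 1%:M 0.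
by under eq_fun do rewrite mulmx1 subr0.
Qed.

Lemma compact_sqball (R : realType) (N : nat) (T : set 'rV[R]_N) (r : R) :
  closed T -> (forall x, T x -> rdot x x <= r) -> compact T.
Proof.
move=> Tcl Tr; apply: bounded_closed_compact => //.
exists (r + 1); split; first exact: num_real.
move=> M rM x Tx; rewrite /Num.norm /= mx_normrE; apply: bigmax_le.
  apply: le_trans (ltW rM); rewrite addr_ge0//.
  exact: le_trans (rdot_ge0 x) (Tr _ Tx).
move=> [i j] _ /=; rewrite ord1; apply: le_trans (ltW rM).
have h : (x 0 j) ^+ 2 <= r.
  apply: le_trans (Tr _ Tx); rewrite rdotE (bigD1 j)//= -expr2 lerDl.
  by rewrite sumr_ge0// => l _; rewrite -expr2 sqr_ge0.
rewrite real_ler_norml ?num_real//; apply/andP; split; nra.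
Qed.

Lemma closed_level (R : realType) (N : nat) (g : 'rV[R]_N -> R) (D : set R) :
  continuous g -> closed D -> closed [set x | D (g x)].
Proof. by move=> gc Dc; apply: preimage_closed => // x _; exact: gc. Qed.

Lemma closed_halfspaces (R : realType) (N k : nat) (Phi : set 'cV[R]_N)
  (M : 'M[R]_(N, k)) :
  closed [set x : 'rV[R]_N | (forall f, Phi f -> 0 <= (x *m f) 0 0) /\
                             x *m M = 0].
Proof.
rewrite (_ : [set x | _] = (\bigcap_(f in Phi) [set x | 0 <= (x *m f) 0 0]) `&`
    (\bigcap_(j in [set: 'I_k]) [set x | (x *m M) 0 j = 0])).
  apply: closedI; [apply: closed_bigI => f _|apply: closed_bigI => j _].
    exact: closed_level (@continuous_mulmx_coord _ _ _ f 0) (@closed_ge _ 0).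
  exact: closed_level (@continuous_mulmx_coord _ _ _ M j) (@closed_eq _ 0).
rewrite eqEsubset; split=> x /= [xP xM]; split.
- by move=> f /xP.
- by move=> j _; rewrite /= xM mxE.
- by move=> f /xP.
- by apply/rowP => j; rewrite (xM j)// mxE.
Qed.

Section NearestPoint.
Variables (R : realType) (N k : nat) (T : set 'rV[R]_N) (L : 'M[R]_(N, k)).
Hypothesis T_closed : closed T.
Hypothesis T0 : T 0.
Hypothesis T_scale : forall t x, 0 <= t -> T x -> T (t *: x).
Hypothesis T_ker : forall x, T x -> x *m L = 0 -> x = 0.

(** The squared norm of x L has a minimum on the compact set of unit vectors of
T, positive because T meets the kernel of L only at 0; homogeneity extends the
bound to T. *)
Lemma cone_coercive :
  exists2 c : R, 0 < c & forall x, T x -> c * rdot x x <= rdot (x *m L) (x *m L).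
Proof.
pose S := T `&` [set x | rdot x x = 1].
have normalize x : T x -> x != 0 ->
    exists2 t, 0 < t & S (t *: x) /\ t ^+ 2 * rdot x x = 1.
  move=> Tx x0; have xx := rdot_gt0 x0.
  have tx : (Num.sqrt (rdot x x))^-1 ^+ 2 * rdot x x = 1.
    by rewrite exprVn sqr_sqrtr ?ltW// mulVf// gt_eqF.
  exists (Num.sqrt (rdot x x))^-1; first by rewrite invr_gt0 sqrtr_gt0.
  split=> //; split; first by apply: T_scale => //; rewrite invr_ge0 sqrtr_ge0.
  by rewrite /= rdotZl rdotC rdotZl mulrA -expr2.
have [S0|/set0P/negP/negPn/eqP S0] := pselect (S !=set0); last first.
  exists 1 => // x Tx; have [->|x0] := eqVneq x 0.
    by rewrite mul0mx !rdot0l mulr0.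
  by have [t _ []] := normalize x Tx x0; rewrite S0.
have S_closed : closed S.
  apply: closedI => //.
  exact: closed_level (@continuous_sqnorm R N) (@closed_eq _ 1).
have [] := @EVT_min_rV R N (fun x => rdot (x *m L - 0) (x *m L - 0)) S S0.
- by apply: (compact_sqball (r := 1)) => // x [_ /= ->].
- by apply: continuous_subspaceT => x; exact: continuous_sqdist.
move=> z; rewrite inE => -[Tz zz] zmin.
exists (rdot (z *m L) (z *m L)).
  apply: rdot_gt0; apply/eqP => /(T_ker Tz) z0.
  by move: zz; rewrite /= z0 rdot0l => /eqP; rewrite eq_sym oner_eq0.
move=> x Tx; have [->|x0] := eqVneq x 0.
  by rewrite mul0mx !rdot0l mulr0.
have [t t0 [Stx tx]] := normalize x Tx x0.
have := zmin (t *: x) (mem_set Stx).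
rewrite !subr0 -scalemxAl !rdotZl ![rdot _ (t *: _)]rdotC !rdotZl.
rewrite mulrA -expr2 => zx.
rewrite -(ler_pM2l (_ : 0 < t ^+ 2)) ?exprn_gt0//.
by rewrite mulrCA tx mulr1.
Qed.

(** By coercivity a point of T far from 0 has an image at least as far from p
as 0 is, so the minimum over a compact part of T is a minimum over T. *)
Lemma cone_nearest (p : 'rV[R]_k) :
  exists2 x0, T x0 & forall x, T x ->
    rdot (x0 *m L - p) (x0 *m L - p) <= rdot (x *m L - p) (x *m L - p).
Proof.
have [c c0 hc] := cone_coercive.
(* Outside this ball the norm of x L exceeds twice that of p. *)
pose r := 4 * rdot p p / c.
pose K := T `&` [set x | rdot x x <= r].
have r0 : 0 <= r by rewrite divr_ge0 ?mulr_ge0 ?rdot_ge0// ltW.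
have K0 : K 0 by split => //=; rewrite rdot0l.
have K_closed : closed K.
  apply: closedI => //.
  exact: closed_level (@continuous_sqnorm R N) (@closed_le _ r).
have [] := @EVT_min_rV R N (fun x => rdot (x *m L - p) (x *m L - p)) K.
- by exists 0.
- by apply: (compact_sqball (r := r)) => // x [].
- by apply: continuous_subspaceT => x; exact: continuous_sqdist.
move=> z; rewrite inE => -[Tz _] zmin; exists z => // x Tx.
have [xr|xr] := leP (rdot x x) r; first by apply: zmin; rewrite inE.
apply: le_trans (zmin 0 (mem_set K0)) _.
rewrite mul0mx sub0r rdotNl rdotC rdotNl opprK.
have far : 4 * rdot p p <= rdot (x *m L) (x *m L).
  apply: le_trans (hc x Tx); move: xr.
  by rewrite /r ltr_pdivrMr// mulrC => /ltW; rewrite mulrC [c * _]mulrC.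
have := rdot_ge0 (x *m L + (- 2) *: p).
have := rdot_sqD (x *m L) p (- 2).
have := rdot_sqD (x *m L) p (- 1).
rewrite scaleN1r => -> -> h; rewrite !mulr2n in h *; lra.
Qed.

End NearestPoint.

(** A closed convex cone H, given by the half-spaces Phi, is sent by L onto a
cone that can be strictly separated from the points outside it, as soon as
the intersection of H with the kernel of L is a subspace.  The subspace is
presented as the common kernel of L and F.  Quotienting by it reduces to
a cone meeting the kernel of L only at 0, where the residual of the nearest
image point is the separating functional. *)
Lemma cone_alternative (R : realType) (N k l : nat) (Phi : set 'cV[R]_N)
  (L : 'M[R]_(N, k)) (F : 'M[R]_(N, l)) (p : 'rV[R]_k)
  (H := [set x : 'rV[R]_N | forall f, Phi f -> 0 <= (x *m f) 0 0])
  (kerF : forall x, x *m F = 0 -> H x)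
  (kerL : forall x, H x -> x *m L = 0 -> x *m F = 0) :
  (exists2 x, H x & x *m L = p) \/
  (exists2 q, (forall x, H x -> 0 <= rdot (x *m L) q) & rdot p q < 0).
Proof.
have HD x y : H x -> H y -> H (x + y).
  by move=> Hx Hy f Pf; rewrite mulmxDl mxE addr_ge0 ?Hx ?Hy.
have HZ t x : 0 <= t -> H x -> H (t *: x).
  by move=> t0 Hx f Pf; rewrite -scalemxAl mxE mulr_ge0 ?Hx.
(* The idempotent G has the kernel of M, the common kernel of L and F.  It
   maps H into H without changing images under L, so H may be replaced by its
   part T in the image of G, a complement of that kernel. *)
pose M := row_mx L F; pose G := M *m pinvmx M.
have GM : G *m M = M by rewrite mulmxKpV.
have GG : G *m G = G by rewrite {2}/G mulmxA GM.
have MG (x : 'rV_N) : (x - x *m G) *m M = 0 by rewrite mulmxBl -mulmxA GM subrr.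
have HG x : H x -> H (x *m G).
  move=> Hx; rewrite -[x *m G](subrK x) addrC; apply: HD => //.
  apply: kerF; rewrite -opprB mulNmx; have := MG x.
  by rewrite mul_mx_row -row_mx0 => /eq_row_mx[_ ->]; rewrite oppr0.
have LG (x : 'rV_N) : x *m G *m L = x *m L.
  have := MG x; rewrite mul_mx_row -row_mx0 => /eq_row_mx[+ _].
  by rewrite mulmxBl => /subr0_eq.
pose T := [set x : 'rV_N |
  (forall f, Phi f -> 0 <= (x *m f) 0 0) /\ x *m (1%:M - G) = 0].
have T_scale t x : 0 <= t -> T x -> T (t *: x).
  move=> t0 [Hx xG]; split; first exact: HZ.
  by rewrite -scalemxAl xG scaler0.
have T_ker x : T x -> x *m L = 0 -> x = 0.
  move=> [Hx]; rewrite mulmxBr mulmx1 => /subr0_eq xG xL.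
  by rewrite xG /G mulmxA mul_mx_row xL (kerL x)// row_mx0 mul0mx.
have [] := cone_nearest (closed_halfspaces (M := 1%:M - G)) _ T_scale T_ker p.
  by split=> [f _|]; rewrite mul0mx ?mxE.
move=> x0 [Hx0 _] x0min.
have {}x0min x : H x -> rdot (x0 *m L - p) (x0 *m L - p) <=
                        rdot (x *m L - p) (x *m L - p).
  move=> Hx; rewrite -(LG x); apply: x0min; split; first exact: HG.
  by rewrite mulmxBr mulmx1 -mulmxA GG subrr.
have [<-|x0p] := eqVneq (x0 *m L) p; first by left; exists x0.
right; set q := x0 *m L - p; exists q.
  (* Moving from x0 towards x0 + x stays in H. *)
  move=> x Hx; rewrite rdotC; apply: (@first_order_ge0 _ _ (rdot (x *m L) (x *m L))).
  move=> t /andP[t0 _]; rewrite -(lerD2l (rdot q q)) addr0 -rdot_sqD.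
  have /x0min := HD _ _ Hx0 (HZ t x (ltW t0) Hx).
  by rewrite mulmxDl -scalemxAl addrAC.
have q_x0 : rdot q (x0 *m L) <= 0.
  rewrite -oppr_ge0; apply: (@first_order_ge0 _ _ (rdot (x0 *m L) (x0 *m L))).
  move=> t /andP[_ t1]; rewrite mulrN -mulNr -sqrrN.
  rewrite -(lerD2l (rdot q q)) addr0 -rdot_sqD.
  have t1' : 0 <= 1 - t by rewrite subr_ge0.
  have /x0min := HZ _ _ t1' Hx0.
  by rewrite scalerBl scale1r mulmxBl -scalemxAl scaleNr addrAC.
have -> : p = x0 *m L + (-1) *: q by rewrite scaleN1r opprB addrC subrK.
rewrite rdotDl rdotZl mulN1r rdotC subr_lt0.
by apply: le_lt_trans q_x0 _; apply: rdot_gt0; rewrite subr_eq0.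
Qed.

(** * Positive semidefinite matrices *)

Section PsdMatrices.
Variables (R : realType).

Lemma symmxP n (S : 'M[R]_n) : S \is symmetricmx <-> S^T = S.
Proof.
rewrite is_hermitianmxE expr0 scale1r map_mx_id//.
by split=> [/eqP <-|->] //; rewrite ?trmxK.
Qed.

Lemma psd_sym n (S : 'M[R]_n) : psd S -> S^T = S.
Proof. by case=> /symmxP. Qed.

Lemma col_eq0 n (x : 'cV[R]_n) : (x^T *m x) 0 0 = 0 -> x = 0.
Proof.
move=> h; apply: trmx_inj; rewrite trmx0; apply: rdot_eq0.
by rewrite /rdot trmxK.
Qed.

Lemma psd0 n : psd (0 : 'M[R]_n).
Proof.
split=> [|x]; first by apply/symmxP; rewrite trmx0.
by rewrite mulmx0 mul0mx mxE.
Qed.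

Lemma psd1 n : psd (1%:M : 'M[R]_n).
Proof.
split=> [|x]; first by apply/symmxP; rewrite trmx1.
by rewrite mulmx1 mxE sumr_ge0// => i _; rewrite mxE -expr2 sqr_ge0.
Qed.

Lemma psdD n (S T : 'M[R]_n) : psd S -> psd T -> psd (S + T).
Proof.
move=> pS pT; split=> [|x].
  by apply/symmxP; rewrite linearD/= !psd_sym.
by rewrite mulmxDr mulmxDl mxE addr_ge0//; [apply: pS.2|apply: pT.2].
Qed.

Lemma psd_congr n k (S : 'M[R]_n) (B : 'M[R]_(n, k)) :
  psd S -> psd (B^T *m S *m B).
Proof.
move=> pS; split=> [|x].
  by apply/symmxP; rewrite !trmx_mul trmxK psd_sym// mulmxA.
by have := pS.2 (B *m x); rewrite trmx_mul !mulmxA.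
Qed.

Lemma psdZ n t (S : 'M[R]_n) : 0 <= t -> psd S -> psd (t *: S).
Proof.
move=> t0 pS; split=> [|x].
  by apply/symmxP; rewrite linearZ/= psd_sym.
by rewrite -scalemxAr -scalemxAl mxE mulr_ge0//; apply: pS.2.
Qed.

Lemma mx11_tr (M : 'M[R]_1) : M^T 0 0 = M 0 0.
Proof. by rewrite mxE. Qed.

Lemma quad_sqD n (S : 'M[R]_n) (x y : 'cV[R]_n) (t : R) : S^T = S ->
  ((x + t *: y)^T *m S *m (x + t *: y)) 0 0 =
  (x^T *m S *m x) 0 0 +
    (t * (y^T *m S *m x) 0 0 *+ 2 + t ^+ 2 * (y^T *m S *m y) 0 0).
Proof.
move=> ST; have xy : (x^T *m S *m y) 0 0 = (y^T *m S *m x) 0 0.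
  by rewrite -[LHS]mx11_tr !trmx_mul trmxK ST mulmxA.
have -> : (x + t *: y)^T = x^T + t *: y^T by rewrite linearD linearZ.
rewrite !mulmxDl !mulmxDr -!scalemxAl -!scalemxAr.
rewrite [LHS]mxE [X in X + _]mxE [X in _ + X]mxE [X in _ + X + _]mxE.
rewrite [X in _ + (X + _)]mxE [X in _ + (_ + X)]mxE [X in _ + (_ + _ * X)]mxE.
by rewrite xy mulr2n expr2; ring.
Qed.

(** A psd form vanishing at x is minimal there, so its gradient S x vanishes. *)
Lemma psd_quad_eq0 n (S : 'M[R]_n) (x : 'cV[R]_n) :
  psd S -> (x^T *m S *m x) 0 0 = 0 -> S *m x = 0.
Proof.
move=> pS xx; set y := S *m x.
have yx : (y^T *m S *m x) 0 0 = (y^T *m y) 0 0 by rewrite -mulmxA.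
suff : 0 <= - (y^T *m y) 0 0.
  rewrite oppr_ge0 => h; apply: col_eq0; apply/eqP; rewrite eq_le h/=.
  by rewrite mxE sumr_ge0// => i _; rewrite mxE -expr2 sqr_ge0.
apply: (@first_order_ge0 _ _ ((y^T *m S *m y) 0 0)) => t _.
have := pS.2 (x + (- t) *: y).
by rewrite quad_sqD ?psd_sym// xx yx add0r sqrrN mulrN mulNr.
Qed.

(** Every psd matrix is a sum of rank-one terms u u^T: subtracting
(U x)(U x)^T / (x^T U x) keeps U psd by Cauchy-Schwarz and adds x to its
kernel. *)
Lemma psd_ind n (Q : 'M[R]_n -> Prop) :
  Q 0 -> (forall U (u : 'cV[R]_n), psd U -> Q U -> Q (U + u *m u^T)) ->
  forall U, psd U -> Q U.
Proof.
move=> Q0 QS U; have [r] := ubnP (\rank U); elim: r U => // r IH U rU pU.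
have [[x x0]|nx] := pselect (exists x : 'cV[R]_n, (x^T *m U *m x) 0 0 != 0);
    last first.
  rewrite (_ : U = 0)//; apply/matrixP => i j.
  have : U *m delta_mx j 0 = 0 :> 'cV_n.
    apply: psd_quad_eq0 => //; apply/eqP/negPn/negP => h; apply: nx.
    by exists (delta_mx j 0).
  by rewrite -colE => /matrixP/(_ i 0); rewrite !mxE.
set d := (x^T *m U *m x) 0 0 in x0.
have d0 : 0 < d by rewrite lt0r x0; apply: pU.2.
have dE : x^T *m U *m x = d%:M by exact: mx11_scalar.
pose w := U *m x; pose U' := U - d^-1 *: (w *m w^T).
have wT : w^T = x^T *m U by rewrite trmx_mul psd_sym.
have U'x : U' *m x = 0.
  rewrite mulmxBl -scalemxAl -mulmxA wT dE -/w mul_mx_scalar scalerA.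
  by rewrite mulVf// scale1r subrr.
have pU' : psd U'.
  split=> [|y].
    by apply/symmxP; rewrite linearB linearZ/= trmx_mul trmxK psd_sym.
  (* Cauchy-Schwarz: the form of U' at y is the form of U at the component of
     y that is U-orthogonal to x. *)
  pose a := (y^T *m w) 0 0; have := pU.2 (y - (a / d) *: x).
  have wy : w^T *m y = a%:M.
    by rewrite [LHS]mx11_scalar -mx11_tr trmx_mul trmxK.
  have -> : (y^T *m U' *m y) 0 0 = (y^T *m U *m y) 0 0 - d^-1 * a ^+ 2.
    rewrite mulmxBr mulmxBl -scalemxAr -scalemxAl !mulmxA -(mulmxA _ w^T y) wy.
    rewrite mul_mx_scalar [LHS]mxE [X in _ + X]mxE [X in - X]mxE.
    rewrite [X in _ * X]mxE.
    by rewrite (_ : (y^T *m U *m x) 0 0 = a) ?expr2// /a mulmxA.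
  rewrite -scaleNr quad_sqD ?psd_sym// -/d -wT wy => h; apply: le_trans h _.
  rewrite [_%:M _ _]mxE eqxx mulr1n le_eqVlt; apply/orP; left.
  by apply/eqP; field.
have U'U : (U' <= U)%MS.
  rewrite /U' wT mulmxA scalemxAl -{1}[U]mul1mx -mulmxBl; exact: submxMl.
have rU' : (\rank U' < r)%N.
  apply: (@leq_trans (\rank U)); last by rewrite -ltnS.
  rewrite rank_ltmx// ltmxE U'U; apply/negP => /submxP[D UD].
  by move: x0; rewrite /d -mulmxA UD -[D *m U' *m x]mulmxA U'x !mulmx0 mxE eqxx.
have := QS U' (Num.sqrt d^-1 *: w) pU' (IH _ rU' pU').
rewrite linearZ/= -scalemxAl -scalemxAr scalerA -expr2 sqr_sqrtr ?invr_ge0 1?ltW//.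
by rewrite subrK.
Qed.

End PsdMatrices.

Section Pairing.
Variables (R : realType) (n : nat).
Implicit Types S T U V W X : 'M[R]_n.

Lemma mxdotDr S X Y : mxdot S (X + Y) = mxdot S X + mxdot S Y.
Proof. by rewrite /mxdot mulmxDr linearD. Qed.

Lemma mxdotZr S t X : mxdot S (t *: X) = t * mxdot S X.
Proof. by rewrite /mxdot -scalemxAr linearZ. Qed.

Lemma mxdotDl S T X : mxdot (S + T) X = mxdot S X + mxdot T X.
Proof. by rewrite /mxdot mulmxDl linearD. Qed.

Lemma mxdotZl t S X : mxdot (t *: S) X = t * mxdot S X.
Proof. by rewrite /mxdot -scalemxAl linearZ. Qed.

Lemma mxdot_tr S X : S^T = S -> mxdot S X^T = mxdot S X.
Proof.
by move=> ST; rewrite /mxdot -[in RHS]mxtrace_tr trmx_mul ST mxtrace_mulC.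
Qed.

Lemma mxdot_rank1 S (x : 'cV[R]_n) : mxdot S (x *m x^T) = (x^T *m S *m x) 0 0.
Proof.
by rewrite /mxdot mulmxA mxtrace_mulC mulmxA [in LHS]/mxtrace big_ord1.
Qed.

(** For U a sum of terms u u^T the pairing is the sum of the values u^T S u,
and each of them is zero only if S u is. *)
Lemma psd_mxdot_ge0 S U : psd S -> psd U ->
  0 <= mxdot S U /\ (mxdot S U = 0 -> S *m U = 0).
Proof.
move=> pS; move: U; apply: psd_ind => [|U u pU [SU SU0]].
  by rewrite /mxdot mulmx0 linear0.
rewrite mxdotDr mxdot_rank1; have Su := pS.2 u; split; first exact: addr_ge0.
move=> /eqP; rewrite paddr_eq0// => /andP[/eqP/SU0 e1 /eqP e2].
by rewrite mulmxDr e1 add0r mulmxA (psd_quad_eq0 pS e2) mul0mx.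
Qed.

(** Positivity of the block matrix forces W^T to kill the kernel of U, which
contains the range of S. *)
Lemma mxdot_tan_eq0 S U V : S^T = S -> S *m U = 0 -> psd_tan U V ->
  mxdot S V = 0.
Proof.
move=> ST SU [W [R0 [_ pB]] <-].
have US : U *m S = 0.
  have UT : U^T = U.
    by have := psd_sym pB; rewrite tr_block_mx => /eq_block_mx[].
  by apply: trmx_inj; rewrite trmx_mul ST UT SU trmx0.
have WS : W^T *m S = 0.
  apply/matrixP => i j; pose x := col j S.
  have Ux : U *m x = 0 by rewrite /x colE mulmxA US mul0mx.
  have : block_mx U W W^T R0 *m col_mx x 0 = 0.
    apply: psd_quad_eq0 => //; rewrite -mulmxA mul_block_col !mulmx0 !addr0 Ux.
    by rewrite tr_col_mx mul_row_col mulmx0 trmx0 mul0mx addr0 mxE.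
  rewrite mul_block_col !mulmx0 !addr0 -[RHS]col_mx0 => /eq_col_mx[_].
  by rewrite /x colE mulmxA -colE => /matrixP/(_ i 0); rewrite !mxE.
rewrite mxdotDr mxdot_tr// (_ : mxdot S W = 0) ?addr0//.
by rewrite -mxdot_tr// /mxdot mxtrace_mulC WS linear0.
Qed.

End Pairing.

(** * The set tan(U) and the kernel of U *)

Section KernelProjector.
Variables (R : realType) (n : nat).
Implicit Types U X : 'M[R]_n.

(** A projector onto the kernel of U, in general not orthogonal; all that
matters is that its image is ker U and that it fixes ker U. *)
Definition kerproj U : 'M[R]_n := 1%:M - pinvmx U *m U.

Lemma mul_kerproj U : U *m kerproj U = 0.
Proof. by rewrite /kerproj mulmxBr mulmx1 mulmxA mulmxKpV// subrr. Qed.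

Lemma kerproj_idem U : kerproj U *m kerproj U = kerproj U.
Proof.
by rewrite {1}/kerproj mulmxBl mul1mx -mulmxA mul_kerproj mulmx0 subr0.
Qed.

Lemma kerproj_compress U : (kerproj U)^T *m U *m kerproj U = 0.
Proof. by rewrite -mulmxA mul_kerproj mulmx0. Qed.

(** A form X vanishing on ker U expands through 1 - kerproj U into terms that
all contain a factor U on the left or on the right, so that X = W + W^T with
W = U B.  The block matrix is then the congruence of U by the row (1, B). *)
Lemma psd_tan_kerproj U X : psd U -> X^T = X ->
  (kerproj U)^T *m X *m kerproj U = 0 -> psd_tan U X.
Proof.
move=> pU XT h; pose G := pinvmx U.
(* The term with U on both sides is shared equally between W and W^T. *)
pose B : 'M_n := G^T *m X - 2^-1 *: (G^T *m X *m G *m U).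
have UT := psd_sym pU.
have WT : (U *m B)^T = B^T *m U by rewrite trmx_mul UT.
exists (U *m B).
  exists (B^T *m U *m B); split; first exact: psd_congr.
  have -> : block_mx U (U *m B) (U *m B)^T (B^T *m U *m B) =
      (row_mx 1%:M B)^T *m U *m row_mx 1%:M B.
    rewrite tr_row_mx trmx1 mul_col_mx mul1mx mul_col_row !mulmx1.
    by rewrite WT.
  exact: psd_congr.
have BT : B^T = X *m G - 2^-1 *: (U *m G^T *m X *m G).
  by rewrite /B linearB linearZ /= !trmx_mul !trmxK XT UT !mulmxA.
rewrite WT BT mulmxBr mulmxBl -scalemxAr -scalemxAl !mulmxA.
have PT : (kerproj U)^T = 1%:M - U *m G^T.
  have -> : U *m G^T = (G *m U)^T by rewrite [RHS]trmx_mul UT.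
  by rewrite /kerproj linearB /= trmx1.
move: h; rewrite PT /kerproj -/G.
rewrite mulmxBl mul1mx !mulmxBr mulmx1 mulmxBl !mulmxA.
move: (U *m G^T *m X) (X *m G *m U) (_ *m U) => a c d h.
rewrite addrACA -opprD -scalerDl (_ : 2^-1 + 2^-1 = 1); last by lra.
rewrite scale1r.
by apply/eqP; rewrite eq_sym -subr_eq0 -h; apply/eqP; rewrite !opprD !opprK !addrA.
Qed.

End KernelProjector.

(** * Facial reduction *)

Section Chains.
Variables (R : realType) (m n : nat) (A : m.-tuple 'M[R]_n) (C : 'M[R]_n).
Implicit Types U V X Y : 'M[R]_n.

Lemma psd_tan_sym U V : psd_tan U V -> V^T = V.
Proof. by case=> W _ <-; rewrite linearD/= trmxK addrC. Qed.

Lemma congrmxD k (P : 'M[R]_(n, k)) X Y :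
  P^T *m (X + Y) *m P = P^T *m X *m P + P^T *m Y *m P.
Proof. by rewrite mulmxDr mulmxDl. Qed.

Lemma congrmxN k (P : 'M[R]_(n, k)) X : P^T *m (- X) *m P = - (P^T *m X *m P).
Proof. by rewrite mulmxN mulNmx. Qed.

Lemma congrmxZ k (P : 'M[R]_(n, k)) X t :
  P^T *m (t *: X) *m P = t *: (P^T *m X *m P).
Proof. by rewrite -scalemxAr -scalemxAl. Qed.

Lemma congrmx_kerproj_idem U X (Z := (kerproj U)^T *m X *m kerproj U) :
  (kerproj U)^T *m Z *m kerproj U = Z.
Proof.
by rewrite /Z !mulmxA -trmx_mul kerproj_idem -!mulmxA kerproj_idem.
Qed.

(** The compression of X to ker U is the psd summand; the remainder vanishes
on ker U. *)
Lemma minkowski_psd_tan U X : psd U -> X^T = X ->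
  psd ((kerproj U)^T *m X *m kerproj U) -> minkowski_add psd (psd_tan U) X.
Proof.
move=> pU XT pX; set Z := _ *m kerproj U in pX.
exists Z => //; exists (X - Z); last by rewrite addrC subrK.
apply: psd_tan_kerproj => //; first by rewrite linearB/= XT psd_sym.
by rewrite congrmxD congrmxN congrmx_kerproj_idem subrr.
Qed.

Definition Ram_step U' U V : Prop :=
  [/\ opA A (U + V) = 0, mxdot C (U + V) = 0, psd U & psd_tan U' V].

Definition Ram_chain (k : nat) (u v : nat -> 'M[R]_n) : Prop :=
  [/\ u 0 = 0, v 0 = 0 & forall i, (0 < i <= k)%N -> Ram_step (u i.-1) (u i) (v i)].

Lemma Ram_chain_psd k u v i : Ram_chain k u v -> (i <= k)%N -> psd (u i).
Proof.
case=> u0 _ h; case: i => [_|i ik]; first by rewrite u0; exact: psd0.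
by have [] := h i.+1 ik.
Qed.

Lemma Ram_chain_extend k u v U V : Ram_chain k u v -> Ram_step (u k) U V ->
  exists u' v', Ram_chain k.+1 u' v' /\ u' k.+1 = U.
Proof.
move=> [u0 v0 uv] st.
exists (fun i => if (i <= k)%N then u i else U).
exists (fun i => if (i <= k)%N then v i else V).
rewrite ltnn; split=> //; split=> // i /andP[i0].
rewrite leq_eqVlt => /predU1P[->|]; first by rewrite leqnn ltnn.
rewrite ltnS => ik; rewrite ik (leq_trans (leq_pred _) ik).
by apply: uv; rewrite i0.
Qed.

(** A matrix in the kernel of the constraint map that certifies that all dual
slacks vanish on a further part of ker U. *)
Definition reducing U Y : Prop :=
  [/\ Y^T = Y, opA A Y = 0, mxdot C Y = 0,
      psd ((kerproj U)^T *m Y *m kerproj U) &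
      (kerproj U)^T *m Y *m kerproj U != 0].

Lemma mulmx_psdD_eq0 k (S T : 'M[R]_n) (B : 'M[R]_(n, k)) :
  psd S -> psd T -> (S + T) *m B = 0 -> S *m B = 0.
Proof.
move=> pS pT STB; apply/matrixP => i j; pose x := col j B.
have STx : (S + T) *m x = 0 by rewrite /x colE mulmxA STB mul0mx.
have : S *m x = 0.
  apply: psd_quad_eq0 => //; apply/eqP; rewrite eq_le pS.2 andbT.
  have : (x^T *m S *m x) 0 0 + (x^T *m T *m x) 0 0 = 0.
    transitivity ((x^T *m ((S + T) *m x)) 0 0); last by rewrite STx mulmx0 mxE.
    by rewrite mulmxDl mulmxDr !mulmxA [RHS]mxE.
  by move=> /eqP; rewrite addr_eq0 => /eqP ->; rewrite oppr_le0 pT.2.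
by rewrite /x colE mulmxA -colE => /matrixP/(_ i 0); rewrite !mxE.
Qed.

(** The compression Z of Y to ker U is psd, and U + Z has a strictly smaller
kernel than U because Z is nonzero there.  The correction Y - (U + Z) lies in
tan(U), since Y and Z agree on ker U. *)
Lemma Ram_step_reduce U Y : psd U -> reducing U Y ->
  exists U' V, Ram_step U U' V /\ (\rank U < \rank U')%N.
Proof.
move=> pU [YT AY CY pY Y0]; set Z := _ *m kerproj U in pY Y0.
have ZP : Z *m kerproj U = Z by rewrite /Z -mulmxA kerproj_idem.
have UP := mul_kerproj U.
exists (U + Z), (Y - (U + Z)); split.
  split; [by rewrite addrC subrK|by rewrite addrC subrK|exact: psdD|].
  apply: psd_tan_kerproj => //; first by rewrite linearB linearD/= YT !psd_sym.
  rewrite congrmxD congrmxN congrmxD -/Z congrmx_kerproj_idem.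
  by rewrite kerproj_compress add0r subrr.
apply: rank_ltmx; rewrite ltmxE; apply/andP; split.
  by rewrite submxE; apply/eqP/mulmx_psdD_eq0; [| |exact: mulmx_coker].
apply/negP => /submxP[D UZ].
move/eqP: Y0; apply; rewrite -[LHS]ZP -[LHS]add0r -[X in X + _]UP.
by rewrite -mulmxDl UZ -mulmxA UP mulmx0.
Qed.

Lemma opAD X Y : opA A (X + Y) = opA A X + opA A Y.
Proof. by apply/colP => i; rewrite !mxE mxdotDr. Qed.

Lemma opAZ t X : opA A (t *: X) = t *: opA A X.
Proof. by apply/colP => i; rewrite !mxE mxdotZr. Qed.

Lemma opA0 : opA A 0 = 0.
Proof. by apply/colP => i; rewrite !mxE /mxdot mulmx0 linear0. Qed.

(** Pads a chain that cannot be reduced further, so that all chains reach the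
prescribed length. *)
Lemma Ram_step_stall U : psd U -> Ram_step U U (- U).
Proof.
move=> pU; split=> //; first by rewrite subrr opA0.
  by rewrite subrr /mxdot mulmx0 linear0.
apply: psd_tan_kerproj => //; first by rewrite linearN/= psd_sym.
by rewrite -mulmxA mulNmx mul_kerproj oppr0 mulmx0.
Qed.

(** As long as a reducing direction exists each step raises the rank by at
least one; once none exists, stalling keeps it so. *)
Lemma facial_reduction k : exists u v, Ram_chain k u v /\
  ((forall Y, ~ reducing (u k) Y) \/ (k <= \rank (u k))%N).
Proof.
elim: k => [|k [u [v [uv IH]]]].
  exists (fun=> 0), (fun=> 0); split; last by right.
  by split=> // i; case: i => [|i]; rewrite ?ltn0.
have pu := Ram_chain_psd uv (leqnn k).
have [[Y rY]|nY] := pselect (exists Y, reducing (u k) Y).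
  have [U [V [st rk]]] := Ram_step_reduce pu rY.
  have [u' [v' [uv' u'E]]] := Ram_chain_extend uv st.
  exists u', v'; split=> //; right; rewrite u'E; case: IH => [/(_ Y)//|kr].
  exact: leq_ltn_trans rk.
have [u' [v' [uv' u'E]]] := Ram_chain_extend uv (Ram_step_stall pu).
exists u', v'; split=> //; left=> Y; rewrite u'E => rY.
by apply: nY; exists Y.
Qed.

End Chains.

(** * Attainment when no reducing direction remains *)

Section Duality.
Variables (R : realType) (m n : nat) (A : m.-tuple 'M[R]_n) (C : 'M[R]_n).
Hypothesis A_sym : forall i : 'I_m, tnth A i \is symmetricmx.
Hypothesis C_sym : C \is symmetricmx.
Implicit Types U V X Y : 'M[R]_n.

Definition adjA (y : 'cV[R]_m) : 'M[R]_n := \sum_(i < m) y i 0 *: tnth A i.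

Lemma adjAD y z : adjA (y + z) = adjA y + adjA z.
Proof.
by rewrite /adjA -big_split/=; apply: eq_bigr => i _; rewrite mxE scalerDl.
Qed.

Lemma adjAZ t y : adjA (t *: y) = t *: adjA y.
Proof.
by rewrite /adjA scaler_sumr; apply: eq_bigr => i _; rewrite mxE scalerA.
Qed.

Lemma adjA_sym y : (adjA y)^T = adjA y.
Proof.
rewrite /adjA linear_sum/=; apply: eq_bigr => i _.
by rewrite linearZ/= (symmxP _).1.
Qed.

Lemma vdotE (y z : 'cV[R]_m) : vdot y z = \sum_i y i 0 * z i 0.
Proof. by rewrite /vdot mxE; apply: eq_bigr => i _; rewrite mxE. Qed.

Lemma vdotDr (b y z : 'cV[R]_m) : vdot b (y + z) = vdot b y + vdot b z.
Proof. by rewrite /vdot mulmxDr mxE. Qed.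

Lemma vdotZr (b y : 'cV[R]_m) t : vdot b (t *: y) = t * vdot b y.
Proof. by rewrite /vdot -scalemxAr mxE. Qed.

Lemma mxdot_adjA y X : mxdot (adjA y) X = vdot (opA A X) y.
Proof.
rewrite /mxdot /adjA mulmx_suml linear_sum vdotE; apply: eq_bigr => i _.
by rewrite -scalemxAl linearZ/= !mxE mulrC.
Qed.

(** The case t > 0 gives the dual feasible point - z / t of value above v.  In
the cases t = 0 and t < 0 one obtains a direction along which (D) stays
feasible and its objective tends to infinity, namely - z and - (z + t y)
respectively, with y feasible of value close enough to v. *)
Lemma no_dual_separation (b : 'cV[R]_m) (v : R) (z : 'cV[R]_m) (t : R) :
  (exists y, D_feasible A C y) ->
  (forall y, D_feasible A C y -> vdot b y <= v) ->
  (forall w, w < v -> exists2 y, D_feasible A C y & w < vdot b y) ->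
  psd (adjA z + t *: C) -> 0 <= vdot b z + t * v.
Proof.
move=> [y0 fy0] bv vb pT; rewrite leNgt; apply/negP => sep.
(* Moving along - d preserves feasibility, and the step s would reach the
   value v + 1. *)
have ray d y : D_feasible A C y -> psd (adjA d) -> 0 <= vdot b d.
  move=> fy pd; rewrite leNgt; apply/negP => bd.
  pose s := (v + 1 - vdot b y) / - vdot b d.
  have s0 : 0 <= s.
    by apply: divr_ge0; [have := bv _ fy; lra|rewrite oppr_ge0 ltW].
  have : D_feasible A C (y + (- s) *: d).
    rewrite /D_feasible /loewner_le -/(adjA _) adjAD adjAZ scaleNr.
    rewrite opprD opprK addrA.
    by apply: psdD => //; apply: psdZ.
  move=> /bv; rewrite vdotDr vdotZr mulNr -mulrN /s divfK ?oppr_eq0 ?lt_eqF//.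
  lra.
have [t0|t0|t0] := ltgtP t 0.
- have wv : vdot b z / - t < v by rewrite ltr_pdivrMr ?oppr_gt0//; lra.
  have [y fy wy] := vb _ wv; rewrite ltr_pdivrMr ?oppr_gt0// in wy.
  have := ray (z + t *: y) y fy; rewrite vdotDr vdotZr adjAD adjAZ.
  have -> : adjA z + t *: adjA y = (adjA z + t *: C) + (- t) *: (C - adjA y).
    by rewrite scalerBr !scaleNr opprK addrA addrK.
  move=> /(_ (psdD pT (psdZ _ fy))); rewrite oppr_ge0 ltW// => /(_ isT); lra.
- have fy : D_feasible A C (- t^-1 *: z).
    rewrite /D_feasible /loewner_le -/(adjA _) adjAZ.
    have -> : C - - t^-1 *: adjA z = t^-1 *: (adjA z + t *: C).
      by rewrite scalerDr scalerA mulVf ?gt_eqF// scale1r scaleNr opprK addrC.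
    by apply: psdZ => //; rewrite invr_ge0 ltW.
  have := bv _ fy; rewrite vdotZr mulNr mulrC -mulNr ler_pdivrMr//; lra.
- have := ray z y0 fy0; move: pT sep; rewrite t0 scale0r addr0 mul0r addr0.
  by move=> pz sep /(_ pz); rewrite leNgt sep.
Qed.

Lemma rdot_mxvec X Y : rdot (mxvec X) (mxvec Y) = \tr (X *m Y^T).
Proof.
rewrite rdotE (reindex _ (curry_mxvec_bij _ _)) /= /mxtrace.
under [RHS]eq_bigr do rewrite mxE.
rewrite pair_bigA; apply: eq_bigr => -[i j] _ /=.
by rewrite !mxvecE mxE.
Qed.

(** The matrix of X |-> (A X, <C, X>) in vectorized form. *)
Definition constraint_mx : 'M[R]_(n * n, m + 1) :=
  row_mx (\matrix_(i, j) mxvec (tnth A j) 0 i) (mxvec C)^T.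

Lemma mul_mxvec_constraint X :
  mxvec X *m constraint_mx = row_mx (opA A X)^T (mxdot C X)%:M.
Proof.
rewrite mul_mx_row; congr row_mx.
  apply/rowP => j; rewrite !mxE.
  transitivity (rdot (mxvec X) (mxvec (tnth A j))).
    by rewrite rdotE; apply: eq_bigr => i _; rewrite mxE.
  by rewrite rdot_mxvec (symmxP _).1// /mxdot mxtrace_mulC.
rewrite [LHS]mx11_scalar; congr _%:M.
by rewrite -[LHS]/(rdot _ _) rdot_mxvec (symmxP _).1// /mxdot mxtrace_mulC.
Qed.

Lemma rdot_row_mx k l (a c : 'rV[R]_k) (b d : 'rV[R]_l) :
  rdot (row_mx a b) (row_mx c d) = rdot a c + rdot b d.
Proof. by rewrite /rdot tr_row_mx mul_row_col mxE. Qed.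

(** The absence of reducing directions is the hypothesis of the separation
alternative for the cone of matrices whose form is nonnegative on ker U.  That
cone is taken among all matrices, so that it is cut out by quadratic
half-spaces alone; symmetrizing changes neither the forms nor the
constraints. *)
Lemma primal_attained U (b : 'cV[R]_m) (v : R) :
  (forall Y, ~ reducing A C U Y) ->
  (exists y, D_feasible A C y) ->
  (forall y, D_feasible A C y -> vdot b y <= v) ->
  (forall w, w < v -> exists2 y, D_feasible A C y & w < vdot b y) ->
  exists X, [/\ X^T = X, opA A X = b, mxdot C X = v &
    psd ((kerproj U)^T *m X *m kerproj U)].
Proof.
move=> nored feas bv vb; set P := kerproj U.
pose Phi := [set f | exists x : 'cV[R]_n,
  f = (mxvec ((P *m x) *m (P *m x)^T))^T].
pose F := lin_mx (mulmxr P \o (mulmx P^T \o (idfun \+ trmx)) : 'M_n -> 'M_n).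
have FE X : mxvec X *m F = mxvec (P^T *m (X + X^T) *m P).
  by rewrite mul_vec_lin.
have PhiE X (x : 'cV_n) : (mxvec X *m (mxvec ((P *m x) *m (P *m x)^T))^T) 0 0 =
    (x^T *m (P^T *m X *m P) *m x) 0 0.
  rewrite -mx11_tr trmx_mul trmxK -[X in mxvec (X *m _)]trmxK mxvec_dotmul.
  by rewrite trmxK trmx_mul !mulmxA.
have symm_sum X : (X + X^T)^T = X + X^T by rewrite linearD/= trmxK addrC.
have quad_symm (x : 'cV[R]_n) (X : 'M_n) :
    (x^T *m (P^T *m (X + X^T) *m P) *m x) 0 0 =
    (x^T *m (P^T *m X *m P) *m x) 0 0 *+ 2.
  rewrite congrmxD mulmxDr mulmxDl [LHS]mxE mulr2n; congr (_ + _).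
  by rewrite -[RHS]mx11_tr !trmx_mul !trmxK !mulmxA.
have psd_symm X : (forall f, Phi f -> 0 <= (mxvec X *m f) 0 0) ->
    psd (P^T *m (X + X^T) *m P).
  move=> HX; split=> [|x].
    by apply/symmxP; rewrite !trmx_mul trmxK symm_sum mulmxA.
  by rewrite quad_symm mulrn_wge0// -PhiE HX//; exists x.
have AT X : opA A X^T = opA A X.
  by apply/colP => i; rewrite !mxE mxdot_tr// (symmxP _).1.
have CT := (symmxP _).1 C_sym.
have [] := @cone_alternative R _ _ _ Phi constraint_mx F (row_mx b^T v%:M).
- move=> x; rewrite -[x]vec_mxK FE => /(congr1 vec_mx).
  rewrite mxvecK linear0 => h _ [y ->]; rewrite PhiE.
  have := quad_symm y (vec_mx x).
  by rewrite h mulmx0 mul0mx mxE => /esym/eqP; rewrite mulrn_eq0 => /eqP ->.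
- move=> x; rewrite -[x]vec_mxK; set X := vec_mx x => HX.
  rewrite mul_mxvec_constraint -row_mx0 => /eq_row_mx[/(congr1 trmx)].
  rewrite trmxK trmx0 => AX /matrixP/(_ 0 0); rewrite !mxE mulr1n => CX.
  rewrite FE; apply/eqP/negPn/negP => h; apply: (nored (X + X^T)); split.
  + exact: symm_sum.
  + by rewrite opAD AT AX addr0.
  + by rewrite mxdotDr mxdot_tr// CX addr0.
  + exact: psd_symm.
  + by apply: contra h => /eqP ->; rewrite linear0.
- move=> [x]; rewrite -[x]vec_mxK; set X := vec_mx x => HX.
  rewrite mul_mxvec_constraint => /eq_row_mx[/trmx_inj AX /matrixP/(_ 0 0)].
  rewrite !mxE !mulr1n => CX; exists (2^-1 *: (X + X^T)); split.
  + by rewrite linearZ /= symm_sum.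
  + apply/colP => i; rewrite -AX !mxE mxdotZr mxdotDr mxdot_tr ?(symmxP _).1//.
    by field.
  + by rewrite mxdotZr mxdotDr mxdot_tr// CX; field.
  + by rewrite congrmxZ; apply: psdZ; [rewrite invr_ge0|exact: psd_symm].
move=> [q]; rewrite -[q]hsubmxK; set z := lsubmx q; set t := rsubmx q => Hq.
rewrite rdot_row_mx ltNge => /negP [].
have pairE (a : 'cV[R]_m) (s : R) : rdot a^T z + rdot s%:M t =
    vdot a z^T + t 0 0 * s.
  rewrite {1}[t]mx11_scalar /rdot tr_scalar_mx -scalar_mxM.
  by rewrite [X in _ + X]mxE eqxx mulr1n mulrC.
rewrite pairE; apply: no_dual_separation => //; split=> [|x].
  by apply/symmxP; rewrite linearD linearZ/= adjA_sym CT.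
rewrite -mxdot_rank1 mxdotDl mxdotZl mxdot_adjA -pairE.
have := Hq (mxvec (x *m x^T)); rewrite mul_mxvec_constraint rdot_row_mx.
apply => _ [y ->]; rewrite PhiE.
(* The functional is tested on x x^T only: psd matrices lie in the cone. *)
rewrite -mulmxA; set w := P *m y.
have -> : (y^T *m (P^T *m (x *m x^T) *m P *m y)) = (w^T *m x) *m (w^T *m x)^T.
  by rewrite !trmx_mul !trmxK !mulmxA.
rewrite [w^T *m x]mx11_scalar tr_scalar_mx -scalar_mxM mxE eqxx mulr1n.
by rewrite -expr2 sqr_ge0.
Qed.

End Duality.

(** * Strong duality *)

Section Final.
Variables (R : realType) (m n : nat) (A : m.-tuple 'M[R]_n) (C : 'M[R]_n).
Hypothesis A_sym : forall i : 'I_m, tnth A i \is symmetricmx.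
Hypothesis C_sym : C \is symmetricmx.
Implicit Types U V X Y : 'M[R]_n.

Lemma kerproj_rank_le1 U : (n <= (\rank U).+1)%N ->
  exists (c : 'cV[R]_n) (r : 'rV[R]_n), kerproj U = c *m r.
Proof.
move=> rU; have rP : (\rank (kerproj U) <= 1)%N.
  have h := mulmx0_rank_max (mul_kerproj U).
  by rewrite -(leq_add2l (\rank U)) addn1; exact: leq_trans h rU.
have [->|/rowV0Pn[r rP' r0]] := eqVneq (kerproj U) 0.
  by exists 0, 0; rewrite mul0mx.
have /submxP[c Pc] : (kerproj U <= r)%MS.
  by rewrite -(geq_leqif (mxrank_leqif_sup rP')) rank_rV r0.
by exists c, r.
Qed.

(** On a line the form of Y is positive, so a large multiple of it dominates
that of X. *)
Lemma reducing_corank1 U X Y : (n <= (\rank U).+1)%N -> reducing A C U Y ->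
  exists s : R, psd ((kerproj U)^T *m (X + s *: Y) *m kerproj U).
Proof.
move=> rU [_ _ _ pY Y0]; have [c [r Pcr]] := kerproj_rank_le1 rU.
have compress Z : (kerproj U)^T *m Z *m kerproj U =
    (c^T *m Z *m c) 0 0 *: (r^T *m r).
  rewrite Pcr trmx_mul !mulmxA -(mulmxA r^T) -(mulmxA r^T).
  set q := c^T *m Z *m c.
  by rewrite {1}[q]mx11_scalar mul_mx_scalar -scalemxAl.
have prr : psd (r^T *m r).
  by have := psd_congr r (psd1 R 1); rewrite mulmx1.
have r0 : 0 < (r *m r^T) 0 0.
  apply: rdot_gt0; apply: contra Y0 => /eqP r0.
  by rewrite compress r0 mulmx0 scaler0.
have y0 : 0 < (c^T *m Y *m c) 0 0.
  have y_neq0 : (c^T *m Y *m c) 0 0 != 0.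
    by apply: contra Y0 => /eqP h; rewrite compress h scale0r.
  rewrite lt0r y_neq0; have := pY.2 r^T; rewrite compress.
  have -> (a : R) : (r^T^T *m (a *: (r^T *m r)) *m r^T) 0 0 =
      a * (r *m r^T) 0 0 ^+ 2.
    rewrite -scalemxAr -scalemxAl [LHS]mxE trmxK mulmxA -[_ *m r *m _]mulmxA.
    by rewrite [in LHS]mxE big_ord1 expr2.
  by rewrite pmulr_lge0// exprn_gt0.
exists (`|(c^T *m X *m c) 0 0| / (c^T *m Y *m c) 0 0).
rewrite compress; apply: psdZ => //.
rewrite congrmxD congrmxZ [X in 0 <= X]mxE [X in _ + X]mxE divfK ?gt_eqF//.
by rewrite addrC -lerBlDr sub0r ler_normr lexx orbT.
Qed.

(** The dual slack D satisfies D U_i = 0 for all i, by induction, hence pairs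
to 0 with tan(U_(n-1)) and nonnegatively with psd matrices. *)
Lemma weak_duality (b : 'cV[R]_m) X (U V : n.-tuple 'M[R]_n) y :
  (0 < n)%N -> Ram_feasible A b C X U V -> D_feasible A C y ->
  vdot b y <= mxdot C X.
Proof.
move=> n0 [_ _ _ AX [S pS [T TU XE]] U0 V0 stA stC stU stV] pD.
pose D := C - adjA A y; have {}pD : psd D := pD; have DT := psd_sym pD.
have CE Z : mxdot C Z = mxdot D Z + vdot (opA A Z) y.
  by rewrite -mxdot_adjA -mxdotDl subrK.
have DU i : (i < n)%N -> D *m U`_i = 0.
  elim: i => [_|i IH ilt]; first by rewrite U0 mulmx0.
  have DV : mxdot D V`_i.+1 = 0.
    exact: mxdot_tan_eq0 DT (IH (ltnW ilt)) (stV i.+1 ilt).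
  have := CE (U`_i.+1 + V`_i.+1).
  rewrite stC// stA// mxdotDr DV.
  rewrite /vdot trmx0 mul0mx [X in _ + X]mxE !addr0 => /esym.
  by apply: (psd_mxdot_ge0 pD _).2; exact: stU.
rewrite CE AX lerDr -XE mxdotDr (mxdot_tan_eq0 DT _ TU) ?addr0.
  exact: (psd_mxdot_ge0 pD pS).1.
by rewrite DU// prednK.
Qed.

Lemma Ram_chain_feasible (b : 'cV[R]_m) X u v : (0 < n)%N ->
  Ram_chain A C n.-1 u v -> X^T = X -> opA A X = b ->
  psd ((kerproj (u n.-1))^T *m X *m kerproj (u n.-1)) ->
  exists U V : n.-tuple 'M[R]_n, Ram_feasible A b C X U V.
Proof.
move=> n0 uv XT AX pX; have pu i (h : (i <= n.-1)%N) := Ram_chain_psd uv h.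
case: (uv) => u0 v0 st.
have lt_le i : (i < n)%N -> (i <= n.-1)%N by case: (n) n0.
pose U := [tuple u i | i < n]; pose V := [tuple v i | i < n].
have UE i : (i < n)%N -> U`_i = u i.
  by move=> h; rewrite (nth_mktuple _ _ (Ordinal h)).
have VE i : (i < n)%N -> V`_i = v i.
  by move=> h; rewrite (nth_mktuple _ _ (Ordinal h)).
have stE i : (0 < i < n)%N -> Ram_step A C U`_i.-1 U`_i V`_i.
  move=> /andP[i0 ilt]; rewrite !UE ?VE ?(leq_ltn_trans (leq_pred i))//.
  by apply: st; rewrite i0 lt_le.
have nlt : (n.-1 < n)%N by rewrite prednK.
exists U, V; split.
- exact/symmxP.
- by move=> i h; rewrite UE//; apply/symmxP/psd_sym/pu/lt_le.
- move=> [h|i h]; apply/symmxP; first by rewrite VE// v0 trmx0.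
  by have [_ _ _ /psd_tan_sym] := stE i.+1 h.
- exact: AX.
- by rewrite UE//; apply: minkowski_psd_tan => //; exact: pu.
- by rewrite UE.
- by rewrite VE.
- by move=> i /stE[].
- by move=> i /stE[].
- by move=> i /stE[].
- by move=> i /stE[].
Qed.

(** When a reducing direction Y remains after n - 1 steps, the matrix 1 has the
zero kernel, hence no reducing direction, and supplies a preimage of (b, v)
that a multiple of Y moves into the cone. *)
Lemma Ram_optimal_exists (b : 'cV[R]_m) (v : R) : (0 < n)%N ->
  (exists y, D_feasible A C y) ->
  (forall y, D_feasible A C y -> vdot b y <= v) ->
  (forall w, w < v -> exists2 y, D_feasible A C y & w < vdot b y) ->
  exists X (U V : n.-tuple 'M[R]_n), Ram_feasible A b C X U V /\ mxdot C X = v.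
Proof.
move=> n0 feas bv vb.
have [u [w [uw red]]] := facial_reduction A C n.-1.
have from_chain X : X^T = X -> opA A X = b -> mxdot C X = v ->
    psd ((kerproj (u n.-1))^T *m X *m kerproj (u n.-1)) ->
    exists X (U V : n.-tuple 'M[R]_n), Ram_feasible A b C X U V /\ mxdot C X = v.
  move=> XT AX CX pX; have [U [V UV]] := Ram_chain_feasible n0 uw XT AX pX.
  by exists X, U, V.
have [[Y rY]|nY] := pselect (exists Y, reducing A C (u n.-1) Y); last first.
  have nred Y : ~ reducing A C (u n.-1) Y by move=> rY; apply: nY; exists Y.
  have [X [XT AX CX pX]] := primal_attained A_sym C_sym nred feas bv vb.
  exact: from_chain XT AX CX pX.
case: red => [/(_ Y)//|rk].
have kp1 : kerproj 1%:M = 0 :> 'M[R]_n.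
  by rewrite -[LHS]mul1mx mul_kerproj.
have nred Z : ~ reducing A C 1%:M Z by case=> _ _ _ _; rewrite kp1 mulmx0 eqxx.
have [X [XT AX CX _]] := primal_attained A_sym C_sym nred feas bv vb.
have rk1 : (n <= (\rank (u n.-1)).+1)%N.
  by rewrite -[X in (X <= _)%N](prednK n0).
have [s ps] := reducing_corank1 X rk1 rY; case: rY => YT AY CY _ _.
apply: from_chain ps; first by rewrite linearD linearZ/= XT YT.
  by rewrite opAD opAZ AX AY scaler0 addr0.
by rewrite mxdotDr mxdotZr CX CY mulr0 addr0.
Qed.

End Final.

Theorem theorem5 (R : realType) (m n : nat) (n_gt0 : (0 < n)%N)
  (A : m.-tuple 'M[R]_n) (b : 'cV[R]_m) (C : 'M[R]_n)
  (A_sym : forall i : 'I_m, tnth A i \is symmetricmx)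
  (A_free : free A)
  (C_sym : C \is symmetricmx)
  (D_feas : exists y : 'cV[R]_m, D_feasible A C y) :
  D_value A b C = Ram_value A b C /\
  (Ram_value A b C \is a fin_num ->
   exists (X : 'M[R]_n) (U V : n.-tuple 'M[R]_n),
     Ram_feasible A b C X U V /\ (mxdot C X)%:E = Ram_value A b C).
Proof.
have weak : (D_value A b C <= Ram_value A b C)%E.
  apply: ge_ereal_sup => _ [y fy <-]; apply: le_ereal_inf_tmp => _ [X [U [V UV]] <-].
  by rewrite lee_fin; exact: weak_duality UV fy.
have attained v : D_value A b C = v%:E ->
    exists X (U V : n.-tuple 'M[R]_n), Ram_feasible A b C X U V /\ mxdot C X = v.
  move=> Dv; apply: Ram_optimal_exists => // [y fy|w wv].
    by rewrite -lee_fin -Dv; apply: ereal_sup_ubound; exists y.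
  have : (w%:E < D_value A b C)%E by rewrite Dv lte_fin.
  by move=> /ereal_sup_gt[_ [y fy <-]]; rewrite lte_fin; exists y.
have equal : D_value A b C = Ram_value A b C.
  case Dv : (D_value A b C) => [v| |].
  - have [X [U [V [UV CX]]]] := attained v Dv.
    apply/eqP; rewrite eq_le -{1}Dv weak /= -CX.
    by apply: ereal_inf_lbound; exists X => //; exists U, V.
  - by apply/esym/eqP; rewrite -leye_eq -Dv.
  - have [y fy] := D_feas; have : ((vdot b y)%:E <= D_value A b C)%E.
      by apply: ereal_sup_ubound; exists y.
    by rewrite Dv leeNy_eq.
split=> //; rewrite -equal => /fineK Dv.
have [X [U [V [UV CX]]]] := attained _ (esym Dv).
by exists X, U, V; split=> //; rewrite CX Dv.
Qed.
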